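(* Let $0<\alpha<1$, let $a<b$ be real, and let $f$ be a differentiable function on $[a,b]$ such that $f'\in L^1(a,b)$. Then, for $a<t<b$, the ABC fractional derivative of $f$ can be expressed as $$ {}^{ABC}D^{\alpha}_{a+}f(t)=\frac{B(\alpha)}{1-\alpha}\sum_{n=0}^{\infty}\Big(\frac{-\alpha}{1-\alpha}\Big)^n\,{}^{RL}I^{\alpha n+1}_{a+}f'(t), $$ this series converging locally uniformly in $t$.
   Context: The Mittag-Leffler function is $E_\alpha(x)=\sum_{n=0}^\infty \frac{x^n}{\Gamma(\alpha n+1)}$. $B$ is a fixed normalisation function with real, strictly positive values and $B(0)=B(1)=1$. For $0<\alpha<1$, $a<t<b$ and $f$ differentiable on $[a,b]$ with $f'\in L^1(a,b)$, the ABC fractional derivative is $$ {}^{ABC}D^{\alpha}_{a+}f(t)=\frac{B(\alpha)}{1-\alpha}\int_a^t f'(x)E_\alpha\Big(\frac{-\alpha}{1-\alpha}(t-x)^{\alpha}\Big)\,\mathrm{d}x. $$ The Riemann--Liouville fractional integral of order $\nu>0$ is ${}^{RL}I^{\nu}_{a+}f(t)=\frac{1}{\Gamma(\nu)}\int_a^t(t-\tau)^{\nu-1}f(\tau)\,\mathrm{d}\tau$. *)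

(* Defs.v *)
From mathcomp Require Import all_boot all_order all_algebra.
From mathcomp Require Import all_classical all_reals all_analysis.

Set Implicit Arguments.
Unset Strict Implicit.
Unset Printing Implicit Defensive.

Import Order.TTheory GRing.Theory Num.Theory.
Import numFieldNormedType.Exports.

Local Open Scope classical_set_scope.
Local Open Scope ring_scope.

(* Euler's integral, convergent exactly for 0 < x; only such x are used. *)
Definition Gamma {R : realType} (x : R) : R :=
  \int[@lebesgue_measure R]_(t in `]0, +oo[) (t `^ (x - 1) * expR (- t)).

Definition mittag_leffler {R : realType} (alpha x : R) : R :=
  limn (series (fun n : nat => x ^+ n / Gamma (alpha * n%:R + 1))).

(* Integrals are over open intervals, so that the values of the integrands at
   the endpoints, where [derive1 f] need not be the one-sided derivative, never
   occur. *)
Definition RL_integral {R : realType} (nu a : R) (g : R -> R) (t : R) : R :=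
  (Gamma nu)^-1 *
  \int[@lebesgue_measure R]_(tau in `]a, t[) ((t - tau) `^ (nu - 1) * g tau).

Definition ABC_derivative {R : realType} (B : R -> R) (alpha a : R)
    (f : R -> R) (t : R) : R :=
  B alpha / (1 - alpha) *
  \int[@lebesgue_measure R]_(x in `]a, t[)
    (derive1 f x * mittag_leffler alpha (- alpha / (1 - alpha) * (t - x) `^ alpha)).

(* The difference quotient is taken inside [a, b]: the derivative is two-sided
   at interior points (where it is [derive1 f x]) and one-sided at a and b.  Values
   of f outside [a, b] are irrelevant. *)
Definition differentiable_on_segment {R : realType} (f : R -> R) (a b : R) :=
  forall x : R, x \in `[a, b] ->
    cvg ((f y - f x) / (y - x) @[y --> within [set` `[a, b]] x^']).

Definition normalisation_function {R : realType} (B : R -> R) :=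
  [/\ forall x : R, x \in `[0, 1] -> 0 < B x, B 0 = 1 & B 1 = 1].

Definition locally_uniformly_cvg {R : realType} (A : set R)
    (s : nat -> R -> R) (l : R -> R) :=
  forall x : R, A x ->
    exists2 U : set R, nbhs x U & {uniform A `&` U, s @ \oo --> l}.

(* Main.v *)
Require Import Defs.
From mathcomp Require Import all_boot all_order all_algebra.
From mathcomp Require Import all_classical all_reals all_analysis.
From mathcomp Require Import measurable_realfun.

Import Order.TTheory GRing.Theory Num.Theory.
Import numFieldNormedType.Exports.

Local Open Scope classical_set_scope.
Local Open Scope ring_scope.

(** With lam = - alpha / (1 - alpha), multiplying out the constants turns the
    n-th term of the series into the integral over ]a, t[ of f' x times the n-th
    term of the Mittag-Leffler series at z = lam (t - x)^alpha.  The theorem is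
    therefore termwise integration of that power series against the integrable
    function f'.

    This is legitimate because the Mittag-Leffler series converges normally on
    bounded sets.  Restricting Euler's integral to ]M, M + 1[ gives
    Gamma (alpha n + 1) >= e^-(M+1) M^(alpha n) for every M > 0
    ([inv_Gamma_le]), and choosing M^alpha larger than twice the bound K on |z|
    makes the n-th term at most C 2^-n ([mittag_leffler_term_le]).  For
    a < x < t < b one has |z| <= |lam| (b - a)^alpha, so C depends neither on x
    nor on t.

    For a series dominated by C r^n, integrating the tail against f' costs at
    most C r^N / (1 - r) times the integral of |f'|
    ([Rintegral_series_geometric_majorant]).  Bounding the integral over ]a, t[
    by the one over ]a, b[ makes this error independent of t and sends it to 0
    as N grows: it yields both the value of the series and its convergence,
    uniform on the whole of ]a, b[. *)

(** * Growth of Gamma and normal convergence of the Mittag-Leffler series *)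

(** Since M is arbitrary, 1 / Gamma x decays faster than any geometric sequence
    in x.  On ]M, M + 1[ the integrand of Euler's integral is at least
    M^(x-1) e^-(M+1), and that interval has length 1. *)
Lemma inv_Gamma_le {R : realType} (M x : R) : 0 < M -> 1 <= x ->
  0 <= (Gamma x)^-1 <= expR (M + 1) / M `^ (x - 1).
Proof.
move=> M0 x1.
have Gx0 : 0 <= Gamma x.
  by apply: Rintegral_ge0 => t _; rewrite mulr_ge0 ?powR_ge0 ?expR_ge0.
rewrite invr_ge0 Gx0 /=.
(* A divergent integral has the real value 0, as has then its inverse, which
   obeys the bound; so the case Gamma x != 0 provides finiteness. *)
have [->|Gx_neq0] := eqVneq (Gamma x) 0.
  by rewrite invr0 divr_ge0 ?expR_ge0 ?powR_ge0.
have Mx0 : 0 < M `^ (x - 1) by exact: powR_gt0.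
have Gx_gt0 : 0 < Gamma x by rewrite lt0r Gx_neq0.
rewrite -[leRHS]invrK lef_pV2 ?posrE ?invr_gt0 ?divr_gt0 ?expR_gt0//.
rewrite invf_div -expRN.
have mG (D : set R) :
    measurable_fun D (EFin \o (fun t : R => t `^ (x - 1) * expR (- t))).
  apply: measurable_funTS; apply/measurable_EFinP.
  apply: measurable_funM; first exact: measurable_powR.
  by apply: measurableT_comp => //; exact: measurable_funN.
have iG0 (D : set R) :
    (0 <= \int[@lebesgue_measure R]_(t in D) (t `^ (x - 1) * expR (- t))%:E)%E.
  by apply: integral_ge0 => t _; rewrite lee_fin mulr_ge0 ?powR_ge0 ?expR_ge0.
have iGfin : (\int[@lebesgue_measure R]_(t in `]0%R, +oo[)
    (t `^ (x - 1) * expR (- t))%:E)%E \is a fin_num.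
  rewrite fin_numElt (lt_le_trans _ (iG0 _)) ?ltNy0//= ltey.
  by apply: contra Gx_neq0 => /eqP Goo; rewrite /Gamma /Rintegral Goo.
rewrite -lee_fin /Gamma /Rintegral fineK//.
have sub : `]M, M + 1[ `<=` (`]0, +oo[%classic : set R).
  by move=> t /=; rewrite !in_itv/= andbT => /andP[/(lt_trans M0)].
apply: (@le_trans _ _ (\int[@lebesgue_measure R]_(t in `]M, (M + 1)%R[)
    (t `^ (x - 1) * expR (- t))%:E)%E); last first.
  apply: ge0_subset_integral => //; first exact: mG.
  by move=> t _; rewrite lee_fin mulr_ge0 ?powR_ge0 ?expR_ge0.
apply: (@le_trans _ _ (\int[@lebesgue_measure R]_(t in `]M, (M + 1)%R[)
    cst (M `^ (x - 1) * expR (- (M + 1)))%:E t)%E).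
  have mu1 : @lebesgue_measure R `]M, M + 1[%classic = 1%E.
    rewrite lebesgue_measure_itv/= lte_fin ltrDl ltr01.
    by rewrite -EFinB addrAC subrr add0r.
  rewrite integral_cst// [leRHS](_ : _ = (M `^ (x - 1) * expR (- (M + 1)))%:E)//.
  by rewrite [X in (_ * X)%E = _]mu1 mule1.
apply: ge0_le_integral => //.
- by move=> t _; rewrite lee_fin mulr_ge0 ?powR_ge0 ?expR_ge0.
- exact: mG.
move=> t /=; rewrite in_itv/= => /andP[Mt tM]; rewrite lee_fin.
apply: ler_pM; rewrite ?powR_ge0 ?expR_ge0//.
  by rewrite ge0_ler_powR ?subr_ge0 ?nnegrE ?(ltW M0) ?(ltW Mt) ?(ltW (lt_trans M0 Mt)).
by rewrite ler_expR lerN2 ltW.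
Qed.

(** Normal convergence on |z| <= K, in the form of a geometric majorant: M in
    [inv_Gamma_le] is free, and M^(alpha n) outgrows (2 K)^n once M^alpha is
    larger than 2 K. *)
Lemma mittag_leffler_term_le {R : realType} (alpha K : R) :
  0 < alpha -> 0 <= K ->
  exists2 C : R, 0 <= C & forall (n : nat) (z : R), `|z| <= K ->
    `|z ^+ n / Gamma (alpha * n%:R + 1)| <= C * 2^-1 ^+ n.
Proof.
move=> alpha0 K0.
(* M is chosen so that M^(alpha n) = L^n, with |z| / L <= 1/2; the summand 1
   keeps L positive when K = 0. *)
pose L : R := 2 * (K + 1); pose M := L `^ (alpha^-1).
have L0 : 0 < L by rewrite mulr_gt0// ltr_wpDl.
have M0 : 0 < M by rewrite powR_gt0.
exists (expR (M + 1)); first exact: expR_ge0.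
move=> n z zK.
have an1 : 1 <= alpha * n%:R + 1 by rewrite lerDr mulr_ge0// ltW.
have /andP[iG0 iGM] := inv_Gamma_le M (alpha * n%:R + 1) M0 an1.
rewrite normrM normrX (ger0_norm iG0).
apply: (@le_trans _ _ ((L / 2) ^+ n * (expR (M + 1) / L ^+ n))).
  apply: ler_pM; rewrite ?exprn_ge0//.
    rewrite lerXn2r ?nnegrE ?divr_ge0 ?(ltW L0)//.
    by rewrite /L mulrAC divff// mul1r (le_trans zK)// lerDl.
  rewrite (le_trans iGM)// addrK /M -powRrM mulrA mulVf ?gt_eqF// mul1r.
  by rewrite powR_mulrn// ltW.
by rewrite exprMn [leLHS]mulrC mulrA divfK// expf_neq0// gt_eqF.
Qed.

(** * Termwise integration *)

Section termwise_integration.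
Context {R : realType}.

(** The tail of the series is dominated by the tail C r^N + C r^(N+1) + ... of
    the geometric one. *)
Lemma series_geometric_majorant (u : nat -> R) (C r : R) : 0 <= r < 1 ->
  (forall n, `|u n| <= C * r ^+ n) ->
  series u @ \oo --> limn (series u) /\
  forall N, `|limn (series u) - series u N| <= C * r ^+ N / (1 - r).
Proof.
move=> /andP[r0 r1] uCr.
have nr1 : `|r| < 1 by rewrite ger0_norm.
have cnu : cvgn [normed series u].
  apply: (series_le_cvg _ _ uCr) => [n //|n|].
    exact: le_trans (uCr n).
  exact: is_cvg_geometric_series.
have cu : cvgn (series u) by exact: normed_cvg.
split=> // N.
have dist_cvg : (fun n => `|series u n - series u N|) @ \oo -->
    `|limn (series u) - series u N|.
  by apply: cvg_norm; apply: cvgB => //; exact: cvg_cst.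
have geo_cvg : series (geometric C r) n - series (geometric C r) N @[n --> \oo]
    --> C * r ^+ N / (1 - r).
  have -> : C * r ^+ N / (1 - r) = C / (1 - r) - series (geometric C r) N.
    rewrite geometric_seriesE ?lt_eqF// /=.
    by rewrite -mulrBl mulrBr mulr1 subKr.
  by apply: cvgB; [exact: cvg_geometric_series|exact: cvg_cst].
rewrite -(cvg_lim _ dist_cvg)// -(cvg_lim _ geo_cvg)//.
apply: ler_lim; [by apply/cvg_ex; eexists; exact: dist_cvg|
  by apply/cvg_ex; eexists; exact: geo_cvg|].
near=> n.
have Nn : (N <= n)%N by near: n; exact: nbhs_infty_ge.
rewrite !sub_series Nn (le_trans (ler_norm_sum _ _ _))//.
exact: ler_sum.
Unshelve. all: by end_near. Qed.

Context {d : measure_display} {T : measurableType d}.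
Context (mu : {measure set T -> \bar R}) (D : set T) (mD : measurable D).

Lemma integrable_mul_bounded (g h : T -> R) (e : R) :
  mu.-integrable D (EFin \o g) -> measurable_fun D h ->
  (forall x, D x -> `|h x| <= e) ->
  mu.-integrable D (EFin \o (fun x => g x * h x)) /\
  `|\int[mu]_(x in D) (g x * h x)| <= e * \int[mu]_(x in D) `|g x|.
Proof.
move=> ig mh he.
have mg : measurable_fun D g by apply/measurable_EFinP; exact: measurable_int ig.
have ing : mu.-integrable D (EFin \o (fun x => `|g x|)).
  exact: (integrable_norm ig).
have ieg : mu.-integrable D (EFin \o (fun x => e * `|g x|)).
  exact: (integrableZl mD e ing).
have le x : D x -> `|g x * h x| <= e * `|g x|.
  by move=> Dx; rewrite normrM mulrC ler_wpM2r// he.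
have igh : mu.-integrable D (EFin \o (fun x => g x * h x)).
  apply: (le_integrable mD _ _ ieg).
    by apply/measurable_EFinP; exact: measurable_funM.
  by move=> x Dx /=; rewrite lee_fin (le_trans (le x Dx))// ler_norm.
split => //; rewrite -RintegralZl//.
rewrite (le_trans (le_normr_Rintegral mD igh))//.
by apply: le_Rintegral => //; exact: (integrable_norm igh).
Qed.

(** The difference is the integral of g times the tail of the series, and the
    tail is bounded on D by its geometric majorant.  The explicit error term is
    what makes the convergence uniform in any parameter on which D and q may
    depend. *)
Lemma Rintegral_series_geometric_majorant (g : T -> R) (q : nat -> T -> R)
    (C r : R) :
  mu.-integrable D (EFin \o g) -> (forall n, measurable_fun D (q n)) ->
  0 <= r < 1 -> (forall n x, D x -> `|q n x| <= C * r ^+ n) ->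
  forall N,
  `|\int[mu]_(x in D) (g x * limn (series (fun n => q n x)))
    - series (fun n => \int[mu]_(x in D) (g x * q n x)) N|
  <= C * r ^+ N / (1 - r) * \int[mu]_(x in D) `|g x|.
Proof.
move=> ig mq r01 qCr N.
pose E x := limn (series (fun n => q n x)).
pose S n x := series (fun n => q n x) n.
have SE x : D x -> (S ^~ x @ \oo --> E x) /\
    forall n, `|E x - S n x| <= C * r ^+ n / (1 - r).
  by move=> Dx; apply: series_geometric_majorant => // n; exact: qCr.
have mS n : measurable_fun D (S n) by exact: measurable_sum.
have mE : measurable_fun D E.
  by apply: (measurable_fun_cvg mS) => x /SE[].
have igq n : mu.-integrable D (EFin \o (fun x => g x * q n x)).
  by have [] := integrable_mul_bounded g (q n) (C * r ^+ n) ig (mq n) (qCr n).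
have [igS sumE] : mu.-integrable D (EFin \o (fun x => g x * S N x)) /\
    series (fun n => \int[mu]_(x in D) (g x * q n x)) N
    = \int[mu]_(x in D) (g x * S N x).
  elim: N => [|n [igS IH]].
    have -> : (fun x => g x * S 0%N x) = cst 0.
      by apply/funext => x; rewrite /S/series/= big_geq// mulr0.
    by split; [exact: integrable0|rewrite /series/= big_geq// Rintegral_cst// mul0r].
  have gSS : (fun x => g x * S n.+1 x) = (fun x => g x * S n x + g x * q n x).
    by apply/funext => x; rewrite /S seriesSr mulrDr.
  rewrite gSS; split; first exact: (integrableD mD igS (igq n)).
  by rewrite seriesSr IH RintegralD.
have [igd ledist] := integrable_mul_bounded g (fun x => E x - S N x)
  (C * r ^+ N / (1 - r)) ig (measurable_funB mE (mS N)) (fun x Dx => (SE x Dx).2 N).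
have igE : mu.-integrable D (EFin \o (fun x => g x * E x)).
  have -> : (fun x => g x * E x) = (fun x => g x * S N x + g x * (E x - S N x)).
    by apply/funext => x; rewrite -mulrDr addrC subrK.
  exact: (integrableD mD igS igd).
rewrite sumE -RintegralB//.
by under eq_Rintegral do rewrite -mulrBr.
Qed.

Lemma ge0_subset_Rintegral (A : set T) (f : T -> R) :
  measurable A -> A `<=` D -> mu.-integrable D (EFin \o f) ->
  (forall x, D x -> 0 <= f x) ->
  \int[mu]_(x in A) f x <= \int[mu]_(x in D) f x.
Proof.
move=> mA AD iF f0; rewrite /Rintegral fine_le//.
- by apply: integrable_fin_num => //; exact: integrableS AD iF.
- exact: integrable_fin_num iF.
apply: ge0_subset_integral => //; first exact: measurable_int iF.
Qed.

End termwise_integration.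

(** * The series of Riemann-Liouville integrals *)

Theorem theorem2p2 (R : realType) (B : R -> R) (alpha a b : R) (f : R -> R)
    (hB : normalisation_function B)
    (halpha0 : 0 < alpha) (halpha1 : alpha < 1)
    (hab : a < b)
    (hf : differentiable_on_segment f a b)
    (hf' : (@lebesgue_measure R).-integrable `]a, b[ (EFin \o derive1 f)) :
  let u (t : R) (n : nat) : R :=
    (- alpha / (1 - alpha)) ^+ n *
    RL_integral (alpha * n%:R + 1) a (derive1 f) t in
  (forall t : R, a < t -> t < b ->
     ABC_derivative B alpha a f t =
     B alpha / (1 - alpha) * limn (series (u t))) /\
  locally_uniformly_cvg `]a, b[
    (fun N t => series (u t) N) (fun t => limn (series (u t))).
Proof.
move=> u.
set lam := - alpha / (1 - alpha) in u *.
pose z t x := lam * (t - x) `^ alpha.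
pose q t n x := z t x ^+ n / Gamma (alpha * n%:R + 1).
pose I t := \int[@lebesgue_measure R]_(x in `]a, t[)
  (derive1 f x * mittag_leffler alpha (z t x)).
have mq t n : measurable_fun `]a, t[ (q t n).
  apply: measurable_funTS; apply: measurable_funM => //.
  apply: measurable_funX; apply: measurable_funM => //.
  apply: (measurableT_comp (measurable_powR alpha)).
  exact: measurable_funB.
have sub t : t < b -> `]a, t[ `<=` `]a, b[%classic.
  by move=> tb x /=; rewrite !in_itv/= => /andP[-> /lt_trans]; apply.
have if' t : t < b ->
    (@lebesgue_measure R).-integrable `]a, t[ (EFin \o derive1 f).
  move=> tb; have := @integrableS _ _ _ _ _ _ _ _ _ _ hf'; apply => //.
  exact: sub.
have tx t x : t < b -> x \in `]a, t[ -> 0 <= t - x <= b - a.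
  rewrite in_itv/= => tb /andP[ax xt].
  by rewrite subr_ge0 (ltW xt) lerB// ltW.
pose K := `|lam| * (b - a) `^ alpha.
have K0 : 0 <= K by rewrite mulr_ge0 ?powR_ge0.
have [C C0 qC] := mittag_leffler_term_le alpha K halpha0 K0.
have zK t x : t < b -> x \in `]a, t[ -> `|z t x| <= K.
  move=> tb xt; have /andP[tx0 tx_le] := tx t x tb xt.
  rewrite normrM (ger0_norm (powR_ge0 _ _)) ler_wpM2l//.
  by rewrite ge0_ler_powR ?(ltW halpha0) ?nnegrE ?(le_trans tx0).
have r01 : 0 <= (2^-1 : R) < 1 by rewrite invr_ge0 invf_lt1// ltr1n ler0n.
(* On ]a, t[ the kernel (t - x)^(alpha n) is the n-th power of (t - x)^alpha, and
   it is bounded, so that the constants may be moved under the integral. *)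
have uE t n : t < b ->
    u t n = \int[@lebesgue_measure R]_(x in `]a, t[) (derive1 f x * q t n x).
  move=> tb; pose p x := (t - x) `^ (alpha * n%:R).
  have mp : measurable_fun `]a, t[ p.
    apply: measurable_funTS; apply: (measurableT_comp (measurable_powR _)).
    exact: measurable_funB.
  have p_le x : x \in `]a, t[ -> `|p x| <= (b - a) `^ (alpha * n%:R).
    move=> xt; have /andP[tx0 tx_le] := tx t x tb xt.
    have an0 : 0 <= alpha * n%:R by rewrite mulr_ge0// ltW.
    by rewrite (ger0_norm (powR_ge0 _ _)) ge0_ler_powR ?an0 ?nnegrE ?(le_trans tx0).
  have [ifp _] := integrable_mul_bounded lebesgue_measure `]a, t[%classic
    (measurable_itv _) (derive1 f) p _ (if' t tb) mp p_le.
  rewrite /u /RL_integral mulrA.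
  under eq_Rintegral do rewrite addrK mulrC.
  rewrite -RintegralZl//.
  apply: eq_Rintegral => x _.
  rewrite /p /q /z powRrM powR_mulrn ?powR_ge0// [in RHS]exprMn.
  by rewrite mulrCA; congr (_ * _); rewrite mulrAC.
pose J := \int[@lebesgue_measure R]_(x in `]a, b[) `|derive1 f x|.
pose err N : R := C * 2^-1 ^+ N / (1 - 2^-1) * J.
have dist_le t N : t < b -> `|I t - series (u t) N| <= err N.
  move=> tb.
  have -> : u t = fun n => \int[@lebesgue_measure R]_(x in `]a, t[)
      (derive1 f x * q t n x) by apply/funext => n; exact: uE.
  apply: le_trans
    (Rintegral_series_geometric_majorant lebesgue_measure `]a, t[%classic _ _
    (q t) C _ (if' t tb) (mq t) r01 _ N) _ => //.
    by move=> n x xt; apply: qC; exact: zK.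
  rewrite ler_wpM2l ?divr_ge0 ?mulr_ge0 ?exprn_ge0 ?subr_ge0 ?invf_le1 ?ler1n//.
  apply: ge0_subset_Rintegral => //; [exact: sub|exact: (integrable_norm hf')].
have err0 : err @ \oo --> 0.
  have -> : err = geometric (C / (1 - 2^-1) * J) 2^-1.
    by apply/funext => N; rewrite /err /= [RHS]mulrAC; congr (_ * _); rewrite mulrAC.
  by apply: cvg_geometric; rewrite ger0_norm; case/andP: r01.
have uI t : t < b -> limn (series (u t)) = I t.
  move=> tb; apply/cvg_lim => //; apply/cvgrPdist_le => e e0.
  move/cvgrPdist_le : err0 => /(_ e e0); apply: filterS => N errN.
  rewrite sub0r normrN in errN; apply: le_trans (dist_le t N tb) _.
  by rewrite (le_trans _ errN)// ler_norm.
split=> [t at_ tb|t _]; first by rewrite uI.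
(* The error bound is uniform on ]a, b[, so any neighbourhood will do. *)
exists setT; first exact: filterT.
rewrite setIT => P /uniform_nbhs[E [entE EP]].
move: entE; rewrite -entourage_from_ballE => -[e /= e0 eE].
move/cvgrPdist_lt : err0 => /(_ e e0); apply: filterS => N errN.
rewrite sub0r normrN in errN; apply: EP => s /=; rewrite in_itv/= => /andP[_ sb].
apply: eE => /=; rewrite /ball/= uI//.
apply: le_lt_trans (dist_le s N sb) _.
by rewrite (le_lt_trans _ errN)// ler_norm.
Qed.
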